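(* Consider an undiscounted ($\gamma=1$) finite Markov decision process with terminal states and a fixed stationary deterministic policy $\pi$ with induced transition matrix $P_\pi$ on the state space $\mathcal S=\mathcal T\cup\mathcal A$, where $\mathcal T$ is the set of transient states and $\mathcal A$ the set of absorbing states of $P_\pi$. Let the reward vector $r$ be non-negative on $\mathcal T$, with $r(s)=0$ for all $s\in\mathcal A$, and let $r_{\mathcal T}$ be its restriction to $\mathcal T$. Let $Q_\pi$ be the restriction of $P_\pi$ to $\mathcal T$, assumed irreducible, with spectral radius $\lambda=\rho(Q_\pi)\in(0,1)$, and let $\nu$ be its quasi-stationary distribution. Let $w$ be the PageRank vector of the time-reversed Doob transform $\widetilde Q^*$ of $Q_\pi$ with teleportation parameter $\lambda$ and restart distribution $u(s)=r(s)\nu(s)/\langle r_{\mathcal T}\rangle_\nu$, $s\in\mathcal T$. Then $$v_\pi(s)=\frac{\langle r_{\mathcal T}\rangle_\nu}{1-\lambda}\,\frac{w(s)}{\nu(s)}\quad\text{for all }s\in\mathcal T,\qquad v_\pi(s)=0\quad\text{for all }s\in\mathcal A.$$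
   Context: A finite Markov decision process has a finite state space $\mathcal S$, a finite action space $\mathscr A$, transition probabilities $p(s'\mid s,a)$ and rewards $r(s,a)$. A stationary deterministic policy is a map $\pi:\mathcal S\to\mathscr A$; it induces the Markov chain $(X_t)_{t\ge0}$ with transition matrix $P_\pi(s,s')=p(s'\mid s,\pi(s))$ and the reward vector $r(s)=r(s,\pi(s))$. A state $s$ is absorbing (terminal) if $P_\pi(s,s)=1$. From every initial state the chain reaches $\mathcal A$ almost surely in finite time. The undiscounted value function is $v_\pi(s)=\mathbb E\big[\sum_{t\ge0}r(X_t)\mid X_0=s\big]$. After reordering states, $$P_\pi=\begin{pmatrix}Q_\pi & P_{\mathcal T\mathcal A}\\ 0& I_{\mathcal A\mathcal A}\end{pmatrix},$$ with $Q_\pi$ substochastic, $P_{\mathcal T\mathcal A}$ the block of transition probabilities from $\mathcal T$ to $\mathcal A$, and $I_{\mathcal A\mathcal A}$ the identity matrix on $\mathcal A$. Notation: $\langle b\rangle_\nu:=\sum_s b(s)\nu(s)$. Quasi-stationary distribution and Doob transform: for an irreducible substochastic matrix $Q$ with spectral radius $\lambda=\rho(Q)\in(0,1)$, let $\nu$ be the strictly positive left eigenvector, $\nu Q=\lambda\nu$, normalized to be a probability vector (the quasi-stationary distribution), and $h$ the strictly positive right eigenvector, $Qh=\lambda h$, normalized by $\nu h=1$. With $H=\mathrm{diag}(h)$, the Doob transform is $\widetilde Q:=\frac1\lambda H^{-1}QH$, a stochastic irreducible matrix with stationary distribution $\widetilde\nu(s)=\nu(s)h(s)$. Its time reversal (the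 time-reversed Doob transform) is $\widetilde Q^*:=\widetilde D^{-1}\widetilde Q^\top\widetilde D=\frac1\lambda D^{-1}Q^\top D$, where $\widetilde D=\mathrm{diag}(\widetilde\nu)$ and $D=\mathrm{diag}(\nu)$; it is row-stochastic. PageRank: given a row-stochastic matrix $M$, a teleportation parameter $c\in[0,1)$ and a probability vector $u$ (the restart distribution), the PageRank vector is the unique probability row vector $w$ with $w=c\,wM+(1-c)\,u$. *)

(* Defs.v *)
From HB Require Import structures.
From mathcomp Require Import all_boot all_order all_algebra.
From mathcomp Require Import complex.
From mathcomp Require Import all_classical all_reals all_analysis.

Set Implicit Arguments.
Unset Strict Implicit.
Unset Printing Implicit Defensive.

Import Order.TTheory GRing.Theory Num.Theory.

Local Open Scope classical_set_scope.
Local Open Scope ring_scope.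

Record finMDP (R : realType) (S A : finType) := FinMDP {
  trans : S -> A -> S -> R ;
  reward : S -> A -> R ;
  trans_ge0 : forall s a s', 0 <= trans s a s' ;
  trans_sum1 : forall s a, \sum_(s' : S) trans s a s' = 1
}.

Definition policy_trans (R : realType) (S A : finType) (M : finMDP R S A)
    (pi : S -> A) (s s' : S) : R :=
  trans M s (pi s) s'.

Definition policy_reward (R : realType) (S A : finType) (M : finMDP R S A)
    (pi : S -> A) (s : S) : R :=
  reward M s (pi s).

Section MarkovChain.
Context {R : realType} {S : finType}.
Context {d : measure_display} {Omega : measurableType d}.

(* [Pr s] is the law "given X_0 = s". *)
Implicit Types (P : S -> S -> R) (Pr : S -> probability Omega R)
  (X : nat -> Omega -> S).

Definition path_event X (t : nat) (x : nat -> S) : set Omega :=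
  [set om | forall i, (i <= t)%N -> X i om = x i].

(* The last clause is the Markov property
   Pr_s(X_(t+1) = x_(t+1) | X_0 = x_0, ..., X_t = x_t) = P(x_t, x_(t+1))
   multiplied out, so that conditioning events of probability 0 are allowed. *)
Definition markov_chain P Pr X : Prop :=
  [/\ forall t x, measurable (X t @^-1` [set x]),
      forall s, Pr s [set om | X 0%N om = s] = 1%E &
      forall s t (x : nat -> S),
        Pr s (path_event X t.+1 x) =
        (Pr s (path_event X t x) * (P (x t) (x t.+1))%:E)%E].

Definition absorbing P (s : S) : Prop := P s s = 1.

(* Started at s, the chain fails to return to s with positive probability. *)
Definition transient Pr X (s : S) : Prop :=
  (Pr s [set om | exists t, X t.+1 om = s] < 1)%E.

(* Since the summands are functions of the path, v(s) is the expectation of a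
   possibly infinite total reward and takes values in the extended reals. *)
Definition value_function Pr X (r : S -> R) (s : S) : \bar R :=
  (\int[Pr s]_om \sum_(0 <= t <oo) (r (X t om))%:E)%E.

End MarkovChain.

(* Matrices and vectors on a set T of states are indexed by 'I_#|T|, the index
   i standing for the state [enum_val i]. *)
Definition restrict_mx (R : realType) (S : finType) (T : {set S})
    (P : S -> S -> R) : 'M[R]_#|T| :=
  \matrix_(i, j) P (enum_val i) (enum_val j).

Definition restrict_vec (R : realType) (S : finType) (T : {set S})
    (b : S -> R) : 'rV[R]_#|T| :=
  \row_i b (enum_val i).

Section Matrices.
Context {R : realType} {n : nat}.
Implicit Types (Q M : 'M[R]_n) (nu mu b u w : 'rV[R]_n) (h : 'cV[R]_n).

(* The maximal modulus of the complex eigenvalues. *)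
Definition spectral_radius Q : R :=
  sup [set Normc.normc z | z in
         [set z : complex R | eigenvalue (map_mx (real_complex R) Q) z]].

(* For entrywise non-negative matrices. *)
Definition irreducible_nonneg Q : Prop :=
  forall i j, exists2 k, (0 < k)%N & 0 < (Q ^+ k) i j.

Definition prob_vec u : Prop :=
  (forall i, 0 <= u 0 i) /\ \sum_i u 0 i = 1.

Definition bracket b nu : R := \sum_i b 0 i * nu 0 i.

Definition quasi_stationary Q nu : Prop :=
  [/\ forall i, 0 < nu 0 i, prob_vec nu & nu *m Q = spectral_radius Q *: nu].

Definition right_perron Q nu h : Prop :=
  [/\ forall i, 0 < h i 0, Q *m h = spectral_radius Q *: h &
      (nu *m h) 0 0 = 1].

Definition doob Q h : 'M[R]_n :=
  (spectral_radius Q)^-1 *: (invmx (diag_mx h^T) *m Q *m diag_mx h^T).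

Definition doob_stationary nu h : 'rV[R]_n := \row_i (nu 0 i * h i 0).

(* Time reversal of a chain M with stationary distribution mu. *)
Definition time_reversal M mu : 'M[R]_n :=
  invmx (diag_mx mu) *m M^T *m diag_mx mu.

Definition reversed_doob Q nu h : 'M[R]_n :=
  time_reversal (doob Q h) (doob_stationary nu h).

Definition pagerank M (c : R) u w : Prop :=
  prob_vec w /\ w = c *: (w *m M) + (1 - c) *: u.

End Matrices.

(* Main.v *)
Require Import Defs.
From HB Require Import structures.
From mathcomp Require Import all_boot all_order all_algebra.
From mathcomp Require Import complex.
From mathcomp Require Import all_classical all_reals all_analysis.
From mathcomp Require Import measurable_realfun ring.

Set Implicit Arguments.
Unset Strict Implicit.
Unset Printing Implicit Defensive.

Import Order.TTheory GRing.Theory Num.Theory.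
Import numFieldNormedType.Exports.

Local Open Scope classical_set_scope.
Local Open Scope ring_scope.

(** The vector [x = <r>_nu / (1 - lambda) * (w / nu)] solves the Poisson
    equation [x = r + Q x] on the transient states.  Indeed, by
    [reversed_doobE], the reversed Doob transform has the entries
    [Q j i * nu j / (lambda * nu i)]: the eigenvector [h] cancels, and the
    PageRank equation [w = lambda w M + (1 - lambda) u], divided by [nu] and
    rescaled, is exactly the Poisson equation ([pagerank_poisson]).

    The value function solves the same equation, and the solution is unique
    because the chain leaves the transient states geometrically fast.  To see
    this without inverting [1 - Q], extend [x] by 0 to a function [y] on all
    states, so that [y = r + P y].  The expected reward collected before time
    [N] then telescopes to [y s - E_s y(X_N)], and
    [value_function_poisson] reduces the theorem to [E_s y(X_N) --> 0].
    Averaging over the initial state with the weights [nu] turns this remainder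
    into [lambda ^+ N * <y>_nu], by the definition of a quasi-stationary
    distribution; as [nu] is positive and every term is non-negative, each
    single remainder vanishes in the limit ([expectation_state_law_cvg0]).

    The link between the process and its transition matrix is the
    Chapman-Kolmogorov step [state_lawS], obtained by summing the path
    probabilities over the finitely many histories, together with monotone
    convergence for the infinite sum of rewards. *)

(** * The time-reversed Doob transform *)

Section Reversal.
Context {R : realType} {n : nat}.
Implicit Types (Q M : 'M[R]_n) (nu mu b u w : 'rV[R]_n) (h : 'cV[R]_n).

Lemma diag_mx_unit mu : (forall i, mu 0 i != 0) -> diag_mx mu \in unitmx.
Proof.
by move=> mu0; rewrite unitmxE det_diag unitfE; apply/prodf_neq0 => i _.
Qed.

Lemma time_reversalE M mu i j : (forall i, mu 0 i != 0) ->
  time_reversal M mu i j = M j i * mu 0 j / mu 0 i.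
Proof.
move=> mu0; apply: (mulfI (mu0 i)); rewrite mulrC mulrCA mulfV// mulr1 mulrC.
have /matrixP/(_ i j) :
    diag_mx mu *m time_reversal M mu = M^T *m diag_mx mu.
  by rewrite /time_reversal !mulmxA mulmxV ?mul1mx// diag_mx_unit.
by rewrite mul_diag_mx mul_mx_diag !mxE.
Qed.

Lemma doobE Q h i j : (forall i, h i 0 != 0) ->
  doob Q h i j = (spectral_radius Q)^-1 * (Q i j * h j 0 / h i 0).
Proof.
move=> h0; rewrite /doob mxE; congr (_ * _); apply: (mulfI (h0 i)).
have hT0 k : h^T 0 k != 0 by rewrite mxE.
rewrite [RHS]mulrC -[RHS]mulrA mulVf// mulr1.
set N := invmx _ *m _ *m _.
have /matrixP/(_ i j) : diag_mx h^T *m N = Q *m diag_mx h^T.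
  by rewrite /N !mulmxA mulmxV ?mul1mx// diag_mx_unit.
by rewrite mul_diag_mx mul_mx_diag !mxE.
Qed.

(** Reversing with respect to [nu h] undoes the conjugation by [h], so only
    [nu] and [Q] are left. *)
Lemma reversed_doobE Q nu h i j :
  (forall i, nu 0 i != 0) -> (forall i, h i 0 != 0) ->
  reversed_doob Q nu h i j = (spectral_radius Q)^-1 * (Q j i * nu 0 j / nu 0 i).
Proof.
move=> nu0 h0; rewrite /reversed_doob time_reversalE; last first.
  by move=> k; rewrite mxE mulf_neq0.
rewrite doobE// !mxE; move: (spectral_radius Q)^-1 => l; field.
by rewrite !nu0 !h0.
Qed.

End Reversal.

(** * The law of the chain at a fixed time *)

Section Chain.
Context {R : realType} {S : finType}.
Context {d : measure_display} {Omega : measurableType d}.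

Lemma measure_fibres (mu : {measure set Omega -> \bar R}) (F : finType)
    (H : Omega -> F) (B : set Omega) :
  (forall f, measurable (B `&` H @^-1` [set f])) ->
  mu B = (\sum_f mu (B `&` H @^-1` [set f]))%E.
Proof.
move=> mH.
have -> : (\sum_f mu (B `&` H @^-1` [set f]) =
           \sum_(f \in [set: F]) mu (B `&` H @^-1` [set f]))%E.
  rewrite (fsbigE (index_enum F)) ?index_enum_uniq//; last first.
    by move=> i _; rewrite mem_index_enum.
  by apply: eq_bigl => f; rewrite in_setT.
rewrite -measure_fin_bigcup//; last 2 first.
- exact: finite_finset.
- by move=> f g _ _ [om [[_ /= <-] [_ /= <-]]].
by congr (mu _); rewrite -setI_bigcupr -preimage_bigcup;
  apply/seteqP; split => // om ?; split => //; exists (H om).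
Qed.

Context (P : S -> S -> R) (Pr : S -> probability Omega R)
  (X : nat -> Omega -> S).
Context (chain : markov_chain P Pr X).

Definition state_law (s : S) (t : nat) (a : S) : R :=
  fine (Pr s (X t @^-1` [set a])).

Let mX t a : measurable (X t @^-1` [set a]).
Proof. by case: chain. Qed.

Lemma state_lawE s t a : Pr s (X t @^-1` [set a]) = (state_law s t a)%:E.
Proof. by rewrite fineK// fin_num_measure. Qed.

Lemma state_law_ge0 s t a : 0 <= state_law s t a.
Proof. by rewrite -lee_fin -state_lawE. Qed.

Lemma state_law0 s a : state_law s 0 a = (s == a)%:R.
Proof.
have [_ X0 _] := chain.
have [<-|sa] := eqVneq s a; first by rewrite /state_law X0.
apply/EFin_inj; rewrite -state_lawE.
have : Pr s (~` (X 0 @^-1` [set s])) = 0%E.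
  by rewrite probability_setC ?X0 ?subee//; exact: mX.
apply: subset_measure0 => //; first by apply: measurableC; exact: mX.
by move=> om /= -> as'; rewrite as' eqxx in sa.
Qed.

Let mpath t x : measurable (path_event X t x).
Proof.
have -> : path_event X t x = \bigcap_(i in `I_t.+1) (X i @^-1` [set x i]).
  by apply/seteqP; split.
by apply: bigcap_measurable => [|i _]; [exists 0%N | exact: mX].
Qed.

(** Chapman-Kolmogorov.  The Markov property is given for complete paths only,
    so the event [X_(t+1) = b] is split along the histories up to time [t],
    which are then regrouped by their last state. *)
Lemma state_lawS s t b :
  state_law s t.+1 b = \sum_a state_law s t a * P a b.
Proof.
have [_ _ markov] := chain.
pose history om := [ffun i : 'I_t.+1 => X i om].
(* Beyond time t the path of a history continues with the target state b. *)
pose path (f : {ffun 'I_t.+1 -> S}) i := if (i <= t)%N then f (inord i) else b.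
have pathP f : history @^-1` [set f] = path_event X t (path f).
  apply/seteqP; split => om /=.
    by move=> <- i it; rewrite /path it ffunE inordK.
  move=> Xf; apply/ffunP => i; have it : (i <= t)%N by rewrite -ltnS.
  by rewrite ffunE Xf// /path it inord_val.
have path_t f : path f t = f ord_max.
  by rewrite /path leqnn; congr (f _); apply/val_inj; rewrite /= inordK.
have path_t1 f : path f t.+1 = b by rewrite /path ltnn.
have mhist f : measurable (history @^-1` [set f]) by rewrite pathP.
pose p f := fine (Pr s (path_event X t (path f))).
have pE f : Pr s (path_event X t (path f)) = (p f)%:E.
  by rewrite fineK// fin_num_measure.
have lawt a : state_law s t a =
    \sum_(f : {ffun 'I_t.+1 -> S} | f ord_max == a) p f.
  apply/EFin_inj; rewrite -state_lawE.
  rewrite (measure_fibres _ (H := history)); last first.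
    by move=> f; apply: measurableI; first exact: mX.
  rewrite -sumEFin [RHS]big_mkcond/=; apply: eq_bigr => f _.
  case: eqP => [fa|nfa].
    rewrite -pE pathP setIidr// => om /(_ t (leqnn t)) /=.
    by rewrite path_t fa.
  rewrite pathP (_ : _ `&` _ = set0) ?measure0//; apply/seteqP; split => om //=.
  by move=> [Xa /(_ t (leqnn t))]; rewrite Xa path_t => /esym.
apply/EFin_inj; rewrite -state_lawE.
rewrite (measure_fibres _ (H := history)); last first.
  by move=> f; apply: measurableI; first exact: mX.
transitivity (\sum_(f : {ffun 'I_t.+1 -> S}) (p f * P (f ord_max) b)%:E)%E.
  apply: eq_bigr => f _; rewrite EFinM -pE -path_t -(path_t1 f) -markov pathP.
  congr (Pr s _); apply/seteqP; split => om /=.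
    by move=> [Xb Xf] i; rewrite leq_eqVlt => /orP[/eqP->|/Xf].
  by move=> Xf; split=> [|i it]; rewrite Xf// leqW.
rewrite sumEFin; congr _%:E.
rewrite (partition_big (fun f : {ffun _} => f ord_max) xpredT)//=.
apply: eq_bigr => a _; rewrite lawt big_distrl/=.
by apply: eq_bigr => f /eqP->.
Qed.

(* X_t takes finitely many values, so any function of it is measurable. *)
Let mf t (f : S -> R) :
  measurable_fun [set: Omega] (EFin \o (f \o X t)).
Proof.
move=> _ Y mY; rewrite setTI.
rewrite (_ : _ @^-1` Y =
    \bigcup_(a in [set a | Y (f a)%:E]) (X t @^-1` [set a])); last first.
  apply/seteqP; split => om /=; first by exists (X t om).
  by move=> [a Ya ->].
by apply: fin_bigcup_measurable => // a _; exact: mX.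
Qed.

Lemma expectation_state_law s t (f : S -> R) : (forall a, 0 <= f a) ->
  (\int[Pr s]_om (f (X t om))%:E)%E = (\sum_a state_law s t a * f a)%:E.
Proof.
move=> f0.
have fX om : (f (X t om))%:E =
    (\sum_a (f a)%:E * (\1_(X t @^-1` [set a]) om)%:E)%E.
  rewrite (bigD1 (X t om))//= indicE mem_set// mule1 big1 ?adde0// => a aX.
  by rewrite indicE memNset ?mule0// => /= /esym/eqP; exact/negP.
under eq_integral do rewrite fX.
rewrite ge0_integral_sum//.
- rewrite -sumEFin; apply: eq_bigr => a _.
  rewrite ge0_integralZl_EFin//.
  + by rewrite integral_indic// setIT mulrC EFinM -state_lawE muleC.
  + by apply: measurableT_comp => //; exact: measurable_indic.
- move=> a; apply: emeasurable_funM => //.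
  by apply: measurableT_comp => //; exact: measurable_indic.
- by move=> a om _; rewrite mule_ge0// lee_fin.
Qed.

(** Uniqueness for the Poisson equation: each step of the chain trades the
    expected value of [y] for one expected reward, so the expected rewards
    telescope, and the value is [y] as soon as the remainder dies out. *)
Lemma value_function_poisson (r y : S -> R) s :
  (forall a, 0 <= r a) ->
  (forall a, y a = r a + \sum_b P a b * y b) ->
  (fun t => \sum_a state_law s t a * y a) @ \oo --> 0 ->
  value_function Pr X r s = (y s)%:E.
Proof.
move=> r0 yE rem0; have step N : \sum_a state_law s N a * y a =
    \sum_a state_law s N a * r a + \sum_a state_law s N.+1 a * y a.
  under [X in _ = _ + X]eq_bigr do rewrite state_lawS big_distrl/=.
  rewrite exchange_big/= -big_split/=; apply: eq_bigr => a _.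
  rewrite [in LHS]yE mulrDr big_distrr/=; congr (_ + _).
  by apply: eq_bigr => b _; rewrite mulrA.
have partial N : \sum_(0 <= t < N) \sum_a state_law s t a * r a =
    y s - \sum_a state_law s N a * y a.
  elim: N => [|N IH]; last by rewrite big_nat_recr//= IH step; ring.
  rewrite big_geq// (bigD1 s)//= state_law0 eqxx mul1r.
  rewrite big1 ?addr0 ?subrr// => a.
  by rewrite state_law0 eq_sym => /negPf->; rewrite mul0r.
rewrite /value_function integral_nneseries//; last 2 first.
- by move=> t; exact: mf.
- by move=> t om _; rewrite lee_fin.
apply: cvg_lim => //.
under eq_cvg => N.
  under eq_bigr do rewrite expectation_state_law//.
  rewrite sumEFin partial; over.
apply: cvg_EFin; first exact: nearW.
by rewrite -[X in _ --> X]subr0; apply: cvgB => //; exact: cvg_cst.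
Qed.


End Chain.

(** * Extending a vector on a set of states by zero *)

Section ZeroExtension.
Context {R : realType} {S : finType} {T : {set S}}.
Implicit Type x : 'I_#|T| -> R.

(** The sum has at most one term; writing it as a sum avoids a default index
    when [T] is empty and makes [sum_zero_ext] an exchange of sums. *)
Definition zero_ext x (s : S) : R := \sum_(i | enum_val i == s) x i.

Lemma zero_extE x i : zero_ext x (enum_val i) = x i.
Proof.
by rewrite /zero_ext (big_pred1 i)// => j; rewrite /= (inj_eq enum_val_inj).
Qed.

Lemma zero_ext_out x s : s \notin T -> zero_ext x s = 0.
Proof.
by move=> sT; rewrite /zero_ext big_pred0// => i; apply: contraNF sT => /eqP<-;
  exact: enum_valP.
Qed.

Lemma zero_ext_ge0 x s : (forall i, 0 <= x i) -> 0 <= zero_ext x s.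
Proof. by move=> x0; apply: sumr_ge0. Qed.

Lemma sum_zero_ext (F : S -> R) x :
  \sum_s F s * zero_ext x s = \sum_i F (enum_val i) * x i.
Proof.
under eq_bigr do rewrite big_distrr/=.
rewrite (exchange_big_dep xpredT)//=; apply: eq_bigr => i _.
by rewrite (big_pred1 (enum_val i))// => s; rewrite /= eq_sym.
Qed.

End ZeroExtension.

(** * Geometric decay of the mass on the transient states *)

Section Decay.
Context {R : realType} {S : finType}.
Context {d : measure_display} {Omega : measurableType d}.
Context (P : S -> S -> R) (Pr : S -> probability Omega R)
  (X : nat -> Omega -> S).
Context (chain : markov_chain P Pr X).
Context (T : {set S}).
Context (closed : forall a b, a \notin T -> b \in T -> P a b = 0).

Lemma state_law_out s t b : s \notin T -> b \in T -> state_law Pr X s t b = 0.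
Proof.
move=> sT; elim: t b => [|t IH] b bT.
  rewrite (state_law0 chain); case: eqVneq => // sb.
  by rewrite sb bT in sT.
rewrite (state_lawS chain) big1// => a _.
by have [/IH->|/closed->//] := boolP (a \in T); rewrite ?mul0r ?mulr0.
Qed.

(** Started from the weights [m], the chain on [T] keeps its shape and loses a
    factor [l] at each step: nothing flows back into [T] from outside, so the
    eigenvector equation on [T] can be iterated. *)
Lemma quasi_stationary_state_law (m : S -> R) (l : R) t b :
  (forall b, b \in T -> \sum_a m a * P a b = l * m b) -> b \in T ->
  \sum_s m s * state_law Pr X s t b = l ^+ t * m b.
Proof.
move=> mP; elim: t b => [|t IH] b bT.
  rewrite (bigD1 b)//= (state_law0 chain) eqxx mulr1 big1 ?addr0 ?mul1r// => s.
  by rewrite (state_law0 chain) => /negPf->; rewrite mulr0.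
under eq_bigr do rewrite (state_lawS chain) big_distrr/=.
rewrite exchange_big/=.
transitivity (\sum_a l ^+ t * (m a * P a b)).
  apply: eq_bigr => a _.
  have [aT|aT] := boolP (a \in T); last first.
    by rewrite closed// !mulr0; apply: big1 => s _; rewrite !mulr0.
  by rewrite mulrA -IH// big_distrl/=; apply: eq_bigr => s _; rewrite mulrA.
by rewrite -big_distrr/= mP// mulrA exprSr.
Qed.

(** From a state [s] of [T], the expectation is at most [1 / m s] times its
    [m]-weighted sum over all initial states, which is a multiple of [l ^+ t];
    from any other state the chain never meets the support of [y]. *)
Lemma expectation_state_law_cvg0 (m y : S -> R) (l : R) s :
  (forall a, 0 <= m a) -> (forall a, a \in T -> 0 < m a) ->
  (forall b, b \in T -> \sum_a m a * P a b = l * m b) ->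
  `|l| < 1 ->
  (forall a, 0 <= y a) -> (forall a, a \notin T -> y a = 0) ->
  (fun t => \sum_a state_law Pr X s t a * y a) @ \oo --> 0.
Proof.
move=> m0 mT mP l1 y0 yT.
have [sT|sT] := boolP (s \in T); last first.
  rewrite (_ : (fun t => _) = fun=> 0); first exact: cvg_cst.
  apply/funext => t; apply: big1 => a _.
  have [aT|/yT->] := boolP (a \in T); last by rewrite mulr0.
  by rewrite state_law_out// mul0r.
apply: (@squeeze_cvgr _ _ _ _ (fun=> 0)
  (fun t => l ^+ t * (\sum_a m a * y a / m s))); last 2 first.
- exact: cvg_cst.
- by rewrite -[X in _ --> X](mul0r (\sum_a m a * y a / m s));
    apply: cvgMl; exact: cvg_expr.
apply: nearW => t; apply/andP; split.
  by apply: sumr_ge0 => a _; rewrite mulr_ge0// (state_law_ge0 chain).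
rewrite -big_distrl/= mulrA ler_pdivlMr ?mT// mulrC.
have -> : l ^+ t * \sum_a m a * y a =
    \sum_s' m s' * \sum_a state_law Pr X s' t a * y a.
  under [RHS]eq_bigr do rewrite big_distrr/=.
  rewrite exchange_big big_distrr/=; apply: eq_bigr => a _.
  have [aT|/yT->] := boolP (a \in T); last first.
    by rewrite !mulr0 big1// => s' _; rewrite !mulr0.
  rewrite mulrA -quasi_stationary_state_law// big_distrl/=.
  by apply: eq_bigr => s' _; rewrite mulrA.
rewrite [leRHS](bigD1 s)//= lerDl; apply: sumr_ge0 => s' _.
apply: mulr_ge0 => //; apply: sumr_ge0 => a _.
by rewrite mulr_ge0// (state_law_ge0 chain).
Qed.

End Decay.

(** * Absorbing states and the PageRank equation *)

Lemma absorbing_trans0 (R : realType) (S : finType) (P : S -> S -> R) a b :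
  (forall s, 0 <= P a s) -> \sum_s P a s = 1 -> absorbing P a -> a != b ->
  P a b = 0.
Proof.
move=> P0 P1 Paa ab.
have : \sum_(s | s != a) P a s = 0.
  by move: P1; rewrite (bigD1 a)//= Paa -[RHS]addr0 => /addrI.
move/eqP; rewrite psumr_eq0// => /allP/(_ b).
rewrite mem_index_enum => /(_ isT).
by rewrite eq_sym ab => /eqP.
Qed.

(** The PageRank equation at [i], multiplied by [<b>_nu / ((1 - l) * nu i)],
    is the Poisson equation for [x].  When [<b>_nu = 0] the restart vector is
    the junk value 0, but then positivity of [nu] forces [b = 0] and both sides
    vanish. *)
Lemma pagerank_poisson (R : realType) (n : nat) (Q : 'M[R]_n)
    (nu b w : 'rV[R]_n) (h : 'cV[R]_n) i :
  let l := spectral_radius Q in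
  let x j := bracket b nu / (1 - l) * (w 0 j / nu 0 j) in
  0 < l < 1 -> (forall j, 0 < nu 0 j) -> (forall j, 0 < h j 0) ->
  (forall j, 0 <= b 0 j) ->
  pagerank (reversed_doob Q nu h) l
    (\row_j (b 0 j * nu 0 j / bracket b nu)) w ->
  x i = b 0 i + \sum_j Q i j * x j.
Proof.
move=> l x /andP[l0 l1] nu0 h0 b0 [_ wE].
have nun j : nu 0 j != 0 by rewrite gt_eqF.
have hn j : h j 0 != 0 by rewrite gt_eqF.
have [br0|br0] := eqVneq (bracket b nu) 0.
  have -> : b 0 i = 0.
    move/eqP: br0; rewrite psumr_eq0 => [|j _]; last by rewrite mulr_ge0// ltW.
    move=> /allP/(_ i); rewrite mem_index_enum => /(_ isT).
    by rewrite mulf_eq0 (negPf (nun i)) orbF => /eqP.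
  by rewrite /x br0 !mul0r big1 ?addr0// => j _; rewrite !mul0r mulr0.
have l1n : 1 - l != 0 by rewrite subr_eq0 gt_eqF.
have -> : \sum_j Q i j * x j =
    bracket b nu / (1 - l) / nu 0 i * (l * (w *m reversed_doob Q nu h) 0 i).
  rewrite mxE !big_distrr/=; apply: eq_bigr => j _.
  rewrite reversed_doobE// -/l /x; field.
  by rewrite !nun l1n gt_eqF.
have := congr1 (fun v : 'rV_n => v 0 i) wE; rewrite /= 3!mxE [in X in _ + X]mxE.
rewrite [(\row__ _) _ _]mxE => wi; rewrite {1}/x wi; field.
by rewrite nun br0 l1n.
Qed.

Theorem theorem4 (R : realType) (S Act : finType) (M : finMDP R S Act)
    (pi : S -> Act)
    (d : measure_display) (Omega : measurableType d)
    (Pr : S -> probability Omega R) (X : nat -> Omega -> S)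
    (T A : {set S}) (nu : 'rV[R]_#|T|) (h : 'cV[R]_#|T|) (w : 'rV[R]_#|T|) :
  let P := policy_trans M pi in
  let r := policy_reward M pi in
  let v := value_function Pr X r in
  let Q := restrict_mx T P in
  let rT := restrict_vec T r in
  let lambda := spectral_radius Q in
  let u := \row_i (rT 0 i * nu 0 i / bracket rT nu) in
  markov_chain P Pr X ->
  (forall s, s \in T <-> transient Pr X s) ->
  (forall s, s \in A <-> absorbing P s) ->
  T :|: A = [set: S]%SET ->
  (forall s, Pr s [set om | exists t, X t om \in A] = 1%E) ->
  (forall s, s \in T -> 0 <= r s) ->
  (forall s, s \in A -> r s = 0) ->
  irreducible_nonneg Q ->
  0 < lambda < 1 ->
  quasi_stationary Q nu ->
  right_perron Q nu h ->
  pagerank (reversed_doob Q nu h) lambda u w ->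
  (forall i : 'I_#|T|,
     v (enum_val i) = (bracket rT nu / (1 - lambda) * (w 0 i / nu 0 i))%:E) /\
  (forall s, s \in A -> v s = 0%E).
Proof.
move=> P r v Q rT lambda u chain _ absA TA _ r0 rA0 _ l01.
move=> [nu0 _ nuQ] [h0 _ _] wPR.
have P0 a b : 0 <= P a b by exact: trans_ge0.
have P1 a : \sum_b P a b = 1 by exact: trans_sum1.
have [l0 l1] := andP l01.
have offT s : s \notin T -> s \in A.
  move=> sT; have := finset.in_setT s.
  by rewrite -TA finset.in_setU (negPf sT) orFb.
have nuQE i : \sum_j nu 0 j * Q j i = lambda * nu 0 i.
  by have := congr1 (fun v : 'rV_#|T| => v 0 i) nuQ; rewrite !mxE.
(* An absorbing state of T would give nu i <= lambda * nu i. *)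
have TnotA s : s \in A -> s \notin T.
  move=> sA; apply/negP => sT.
  pose i := enum_rank_in sT s.
  have iE : enum_val i = s by rewrite enum_rankK_in.
  have := nuQE i; rewrite (bigD1 i)//= mxE iE (absA s).1//.
  move=> nui; have : nu 0 i <= lambda * nu 0 i.
    rewrite -nui mulr1 lerDl; apply: sumr_ge0 => j _.
    by rewrite mulr_ge0 ?mxE// ltW.
  by rewrite leNgt -[X in _ < X]mul1r ltr_pM2r ?nu0// l1.
have closed a b : a \notin T -> b \in T -> P a b = 0.
  move=> aT bT; apply: absorbing_trans0 => //; first exact/absA/offT.
  by apply: contraNneq aT => ->.
have rT0 i : 0 <= rT 0 i by rewrite mxE; apply/r0/enum_valP.
have rge0 s : 0 <= r s.
  by have [/r0//|/offT/rA0->] := boolP (s \in T).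
pose x i := bracket rT nu / (1 - lambda) * (w 0 i / nu 0 i).
have x0 i : 0 <= x i.
  have [[w0 _] _] := wPR.
  have br0 : 0 <= bracket rT nu.
    by apply: sumr_ge0 => j _; rewrite mulr_ge0// ltW.
  by rewrite mulr_ge0 ?divr_ge0 ?subr_ge0// ltW.
have valueE s : v s = (zero_ext x s)%:E.
  apply: (value_function_poisson chain) => //.
    move=> a; rewrite sum_zero_ext.
    have [aT|aT] := boolP (a \in T); last first.
      rewrite zero_ext_out// rA0 ?offT// add0r big1// => j _.
      by rewrite closed ?mul0r// enum_valP.
    pose i := enum_rank_in aT a.
    have <- : enum_val i = a by rewrite enum_rankK_in.
    rewrite zero_extE /x (pagerank_poisson _ l01 nu0 h0 rT0 wPR) mxE.
    by congr (_ + _); apply: eq_bigr => j _; rewrite mxE.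
  apply: (@expectation_state_law_cvg0 _ _ _ _ _ _ _ chain _ closed
    (zero_ext (nu 0)) _ lambda).
  - by move=> a; apply: zero_ext_ge0 => i; exact: ltW.
  - by move=> a aT; rewrite -(enum_rankK_in aT aT) zero_extE.
  - move=> b bT; rewrite -(enum_rankK_in bT bT) zero_extE -nuQE.
    under eq_bigr do rewrite mulrC.
    by rewrite sum_zero_ext; apply: eq_bigr => j _; rewrite mxE mulrC.
  - by rewrite ger0_norm// ltW.
  - by move=> a; exact: zero_ext_ge0.
  - by move=> a; exact: zero_ext_out.
split=> [i|s /TnotA sT]; first by rewrite valueE zero_extE.
by rewrite valueE zero_ext_out.
Qed.
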